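(* Let $p,q$ be complex constants and let $(a_n^k)_{n,k\ge0}$ be complex numbers satisfying $$a_n^k=\frac{p}{k}\,a_n^{k-1}+\frac{q}{k}\,a_{n+1}^{k-1}\qquad(n\ge0,\ k\ge1).$$ Then, as formal power series, $$\bar a(t)=\exp(pt)\;A(qt).$$
   Context: Superscripts in $a_n^k$ are indices, not powers. The initial sequence $(a_n^0)_{n\ge0}$ is arbitrary. $A(t)=\sum_{n\ge0}a_n^0\frac{t^n}{n!}$ is the exponential generating function of the initial sequence and $\bar a(t)=\sum_{n\ge0}a_0^n t^n$ is the ordinary generating function of the final sequence $(a_0^n)_{n\ge0}$. *)

(* Defs.v *)
From mathcomp Require Import all_boot all_order all_algebra.
From mathcomp Require Import complex reals.

Set Implicit Arguments.
Unset Strict Implicit.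
Unset Printing Implicit Defensive.

Import GRing.Theory.
Local Open Scope ring_scope.

(* A formal power series \sum_n f_n t^n is its sequence of coefficients
   n |-> f_n. *)
Definition fps (K : Type) : Type := nat -> K.

Section FormalPowerSeries.
Variable K : fieldType.
Implicit Types (f g : fps K) (c : K) (u : nat -> K).

Definition fps_mul f g : fps K :=
  fun n => \sum_(i < n.+1) f i * g (n - i)%N.

(* The substitution f(c t) = \sum_n f_n (c t)^n; since c ^+ 0 = 1, the case
   c = 0 gives the constant series f_0. *)
Definition fps_dilate c f : fps K := fun n => f n * c ^+ n.

Definition ogf u : fps K := fun n => u n.

Definition egf u : fps K := fun n => u n / (n`!)%:R.

(* exp(t) = \sum_n t^n / n! *)
Definition fps_exp : fps K := fun n => (n`!)%:R^-1.

End FormalPowerSeries.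

Arguments fps_exp {K}.

(* Main.v *)
(* Setting b_n^k = k! a_n^k clears the denominators: b_n^(k+1) = p b_n^k + q b_(n+1)^k.
   So b^k = (p + q S)^k b^0 for the shift S, and at n = 0 the binomial expansion,
   divided by k!, is the coefficient of t^k in exp(pt) A(qt). *)
Require Import Defs.
From mathcomp Require Import all_boot all_order all_algebra.
From mathcomp Require Import complex reals.
From mathcomp Require Import ring boolp.

Import GRing.Theory Num.Theory.
Local Open Scope ring_scope.

(** Induction on [k] with Pascal's rule, as for the binomial theorem: the shift commutes with the
    scalars [p] and [q]. *)
Lemma shift_recurrence_binomial (K : comNzRingType) (p q : K)
    (b : nat -> nat -> K)
    (hb : forall n k, b n k.+1 = p * b n k + q * b n.+1 k) (n k : nat) :
  b n k = \sum_(i < k.+1) p ^+ (k - i) * q ^+ i * b (n + i)%N 0%N *+ 'C(k, i).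
Proof.
elim: k n => [|k IHk] n; first by rewrite big_ord1 !mul1r addn0.
rewrite hb (IHk n) (IHk n.+1) [RHS]big_ord_recl /=.
(* Pascal's rule: the ['C(k, i.+1)] part, with the head term, matches [p * b n k]; the ['C(k, i)]
   part matches [q * b n.+1 k]. *)
under [X in _ = _ + X]eq_bigr => i _ do
  rewrite /bump leq0n add1n subSS binS mulrnDr addnS -addSn.
rewrite big_split /= addrA; congr (_ + _).
  (* The top term vanishes since ['C(k, k.+1) = 0]. *)
  rewrite [X in _ = _ + X]big_ord_recr /= (@bin_small k k.+1) // mulr0n addr0.
  rewrite mulr_sumr big_ord_recl /= !subn0 !bin0 !mulrA -exprS; congr (_ + _).
  apply: eq_bigr => i _.
  by rewrite /bump leq0n add1n -mulrnAr !mulrA -exprS subnSK // mulrnAr addnS.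
rewrite mulr_sumr; apply: eq_bigr => i _.
by rewrite exprS mulrnAr; congr (_ *+ _); ring.
Qed.

(** In characteristic zero [k!] is invertible, so coefficients of t^k may be compared after
    multiplication by [k!]. *)
Lemma ogf_final_sequence (K : numFieldType) (p q : K) (a : nat -> nat -> K)
    (ha : forall n k : nat, (1 <= k)%N ->
      a n k = p / k%:R * a n (k - 1)%N + q / k%:R * a n.+1 (k - 1)%N) :
  ogf (fun n => a 0%N n) =
  fps_mul (fps_dilate p fps_exp) (fps_dilate q (egf (fun n => a n 0%N))).
Proof.
have fact_neq0 m : (m`!)%:R != 0 :> K by rewrite pnatr_eq0 -lt0n fact_gt0.
have hb n k : (k.+1`!)%:R * a n k.+1 =
    p * ((k`!)%:R * a n k) + q * ((k`!)%:R * a n.+1 k).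
  have k1_neq0 : k.+1%:R != 0 :> K by rewrite pnatr_eq0.
  rewrite ha // subn1 /= factS natrM.
  by move: k.+1%:R k1_neq0 => s s_neq0; field.
apply: functional_extensionality_dep => k.
rewrite /ogf /fps_mul /fps_dilate /egf /fps_exp.
apply: (mulfI (fact_neq0 k)).
rewrite (@shift_recurrence_binomial _ p q (fun n k => (k`!)%:R * a n k) hb).
(* In the product [i] is the exponent of [p], in the binomial sum that of [q]; hence the reversal of
   the latter. *)
rewrite mulr_sumr (reindex_inj rev_ord_inj) /=; apply: eq_bigr => i _.
have le_ik : (i <= k)%N by rewrite -ltnS.
(* Writing [k!] as ['C(k, i) * (i! * (k - i)!)] lets both denominators cancel. *)
rewrite subSS subKn // bin_sub // mul1r add0n -mulr_natr -(bin_fact le_ik) !natrM.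
move: (i`!)%:R (fact_neq0 i) => u u_neq0.
move: ((k - i)`!)%:R (fact_neq0 (k - i)%N) => v v_neq0.
by field; rewrite v_neq0.
Qed.

Theorem theorem21 (R : realType) (p q : complex R)
    (a : nat -> nat -> complex R) (* a n k is a_n^k *)
    (ha : forall n k : nat, (1 <= k)%N ->
      a n k = p / k%:R * a n (k - 1)%N + q / k%:R * a n.+1 (k - 1)%N) :
  ogf (fun n => a 0%N n) =
  fps_mul (fps_dilate p fps_exp) (fps_dilate q (egf (fun n => a n 0%N))).
Proof.
exact: ogf_final_sequence ha.
Qed.
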